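(* Let $(a,b)\in\mathbb{R}^2$ with $a<b$ and let $f\in L^1([a,b];\mathbb{R})$. Then $$\lim_{\alpha\to 0^+}\left\|S_a^\alpha f-I_af\right\|_{L^1([a,b];\mathbb{R})}=0,$$ where $(I_af)(x)=\int_a^x f(y)\,dy$ for $a<x\leq b$.
   Context: Let $\mathcal{S}(t)=e^{-t}\int_0^\infty \frac{t^{s-1}}{\Gamma(s)}\,ds$ for $t>0$, where $\Gamma$ is the Gamma function. For $\alpha>0$, $a<b$ real and $f\in L^1([a,b];\mathbb{R})$, the left-sided fractional integral of second kind of order $\alpha$ of $f$ is $$(S_a^\alpha f)(x)=\int_a^x \mathcal{S}\left(\frac{x-t}{\alpha}\right)f(t)\,dt\quad\text{for a.e. } x\in[a,b].$$ *)

(* Defs.v *)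
From HB Require Import structures.
From mathcomp Require Import all_boot all_order all_algebra.
From mathcomp Require Import all_classical all_reals all_analysis.

Set Implicit Arguments.
Unset Strict Implicit.
Unset Printing Implicit Defensive.

Import Order.TTheory GRing.Theory Num.Theory.
Import numFieldNormedType.Exports.

Local Open Scope classical_set_scope.
Local Open Scope ring_scope.

Definition Gamma (R : realType) (s : R) : R :=
  \int[@lebesgue_measure R]_(t in `]0, +oo[) (t `^ (s - 1) * expR (- t)).

Definition kernelS (R : realType) (t : R) : R :=
  expR (- t) *
  \int[@lebesgue_measure R]_(s in `]0, +oo[) (t `^ (s - 1) / Gamma s).

(* The domain is [`[a, x[] so that [kernelS] is only evaluated at positive
   arguments. At the points x where the integrand is not integrable (a null set
   when f is integrable) the value of the integral is a default one. *)
Definition fracint2 (R : realType) (a alpha : R) (f : R -> R) (x : R) : R :=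
  \int[@lebesgue_measure R]_(t in `[a, x[) (kernelS ((x - t) / alpha) * f t).

Definition primitive (R : realType) (a : R) (f : R -> R) (x : R) : R :=
  \int[@lebesgue_measure R]_(y in `[a, x]) f y.

(* [Lnorm] is taken over the whole line: the norm on [a, b] is that of the
   extension by zero. *)
Definition L1norm (R : realType) (a b : R) (g : R -> R) : \bar R :=
  Lnorm (@lebesgue_measure R) 1%E ((EFin \o g) \_ `[a, b]).

(* Main.v *)
Require Import Defs.
From mathcomp Require Import all_boot all_order all_algebra.
From mathcomp Require Import all_classical all_reals all_analysis.
From mathcomp Require Import measurable_realfun ring lra.

Import Order.TTheory GRing.Theory Num.Theory.
Import numFieldNormedType.Exports.

Local Open Scope classical_set_scope.
Local Open Scope ring_scope.

(** Let h_s(t) = t^(s-1) e^(-t) / Gamma(s) be the Gamma densities, so that the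
    kernel is S(t) = \int_0^oo h_s(t) ds. Integration by parts gives, for s > 1,
    h_(s+1)(x) = P(s,x) - P(s+1,x), where P(s,x) = \int_0^x h_s is the
    distribution function of h_s, and P(s+n,x) -> 0. Hence
    \sum_(n >= 1) h_(s+n)(x) = P(s,x), and slicing the shapes s > 2 into unit
    intervals
      S(x) - 1 = \int_0^2 h_s(x) ds - \int_1^2 (1 - P(s,x)) ds.
    By Tonelli, \int_0^oo |S - 1| <= 2 + \int_1^2 s ds is finite, s being the
    mean of h_s. The difference S_a^alpha f - I_a f is the convolution of f with
    (S - 1)(./alpha), whose L1 norm is O(alpha); conclude by Young's inequality. *)

(** * Affine change of variables, and an exponential bound for powers *)

(** Pushing Lebesgue measure forward along [x |-> (x - c) / k] multiplies it by [k], as is checked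
    on half-open intervals. The case [k = alpha] gives the scaling of the kernel, the case [k = 1]
    the integer shifts of the shape. *)
Lemma ge0_integral_affine {R : realType} (k c : R) (g : R -> \bar R) :
  0 < k -> measurable_fun [set: R] g -> (forall x, (0 <= g x)%E) ->
  (\int[@lebesgue_measure R]_x g (((x : R) - c) / k)%R
   = k%:E * \int[@lebesgue_measure R]_x g x)%E.
Proof.
move=> k0 mg g0.
pose phi (x : measurableTypeR R) : measurableTypeR R := (x - c) / k.
have mphi : measurable_fun setT phi.
  by apply: measurable_funM => //; apply: measurable_funB.
pose pushf : {measure set (measurableTypeR R) -> \bar R} :=
  pushforward (@lebesgue_measure R) phi.
pose nu := pushf mphi.
have E A : measurable A ->
    nu A = mscale (NngNum (ltW k0)) (@lebesgue_measure R) A.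
  move=> mA.
  have kV0 : 0 <= k^-1 by rewrite invr_ge0 ltW.
  have : lebesgue_measure A = mscale (NngNum kV0) nu A.
    apply: lebesgue_measure_unique => // _ [[p q]] _ <-.
    rewrite [RHS](_ : _ = k^-1%:E * lebesgue_measure (phi @^-1` `]p, q]))%E//.
    have -> : phi @^-1` `]p, q] = `](k * p + c), (k * q + c)]%classic.
      apply/seteqP; split => x /=; rewrite !in_itv/= /phi ltr_pdivlMr// ler_pdivrMr//;
      by rewrite ltrBrDr lerBlDr ![k * _]mulrC.
    rewrite !lebesgue_measure_itv/= !lte_fin ltrD2r ltr_pM2l//.
    case: ifPn => _; last by rewrite mule0.
    by rewrite -!EFinB -EFinM; congr EFin; field; rewrite gt_eqF.
  move=> lambdaE; transitivity (k%:E * (k^-1%:E * nu A))%E.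
    by rewrite muleA -EFinM mulfV ?gt_eqF// mul1e.
  by congr (_ * _)%E; exact/esym.
transitivity (\int[mscale (NngNum (ltW k0)) (@lebesgue_measure R)]_x g x)%E; last first.
  by rewrite ge0_integral_mscale.
transitivity (\int[nu]_x g x)%E.
  by rewrite ge0_integral_pushforward.
by apply: eq_measure_integral => A mA _; exact: E.
Qed.

(** The inequality [ln y <= y] at [y = t / (2 * p)], multiplied by [p] and exponentiated. Half of
    the exponential survives on the right, which yields both integrability and decay at infinity. *)
Lemma le_powR_expR {R : realType} (p t : R) : 0 < p -> 0 <= t ->
  t `^ p * expR (- t) <= (2 * p) `^ p * expR (- (t / 2)).
Proof.
move=> p0; rewrite le_eqVlt => /predU1P[<-|t0].
  by rewrite powR0 ?gt_eqF// mul0r mulr_ge0 ?powR_ge0 ?expR_ge0.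
have p20 : 0 < 2 * p by rewrite mulr_gt0.
rewrite /powR !gt_eqF// -!expRD ler_expR.
have : ln (t / (2 * p)) <= t / (2 * p).
  by apply/ltW/ln_sublinear; rewrite divr_gt0.
rewrite ln_div ?posrE// => H.
have : p * (ln t - ln (2 * p)) <= p * (t / (2 * p)) by rewrite ler_pM2l.
have -> : p * (t / (2 * p)) = t / 2 by field; rewrite gt_eqF.
lra.
Qed.

(** * The unnormalised Gamma integrand and the functional equation of [Gamma] *)

Definition gamma_integrand {R : realType} (p t : R) : R := t `^ p * expR (- t).

Section gamma_integrand.
Context {R : realType}.
Local Notation mu := (@lebesgue_measure R).
Implicit Types p q s t x : R.

Lemma gamma_integrand_ge0 p t : 0 <= gamma_integrand p t.
Proof. by rewrite mulr_ge0 ?powR_ge0 ?expR_ge0. Qed.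

Lemma measurable_gamma_integrand p (D : set R) :
  measurable_fun D (gamma_integrand p).
Proof.
apply: (measurable_funS measurableT) => //.
apply: measurable_funM; first exact: measurable_powR.
by apply: measurableT_comp => //; exact: measurable_funN.
Qed.

Lemma is_derive_gamma_integrand p t : 0 < t ->
  is_derive t 1 (gamma_integrand p)
    (p * gamma_integrand (p - 1) t - gamma_integrand p t).
Proof.
move=> t0.
have dexp : is_derive t 1 (fun u : R => expR (- u)) (- expR (- t)).
  have dN : is_derive t 1 (-%R : R -> R) (-1) by exact: is_deriveNid.
  have de : is_derive (- t) 1 expR (expR (- t)) by exact: is_derive_expR.
  by have := is_derive1_comp de dN; rewrite mulrN1.
apply: is_derive_eq; first exact: (is_deriveM (is_derive1_powR p t0) dexp).
rewrite /gamma_integrand /GRing.scale/=. ring.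
Qed.

Lemma gamma_integrand_cvg0 p : 0 < p -> gamma_integrand p t @[t --> 0^'+] --> 0.
Proof.
move=> p0; rewrite -[X in _ --> X](mul0r (expR (- 0)) : _ = 0).
apply: cvgM; first exact: powR_cvg0.
apply: cvg_at_right_filter.
by apply: continuous_comp; [exact: opp_continuous|exact: continuous_expR].
Qed.

Lemma within_continuous_gamma_integrand p x : 0 < p -> 0 < x ->
  {within `[0, x], continuous (gamma_integrand p)}.
Proof.
move=> p0 x0.
have ct t : 0 < t -> {for t, continuous (gamma_integrand p)}.
  move=> t0; apply: differentiable_continuous; apply/derivable1_diffP.
  by have [] := is_derive_gamma_integrand p t t0.
apply/(continuous_within_itvP _ x0); split.
- by move=> t; rewrite in_itv/= => /andP[t0 _]; exact: ct.
- rewrite [X in _ --> X](_ : _ = 0); first exact: gamma_integrand_cvg0.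
  by rewrite /gamma_integrand powR0 ?gt_eqF// mul0r.
- by apply: cvg_at_left_filter; exact: ct.
Qed.

(** Integration by parts: the derivative of [gamma_integrand p] integrates over [[0, x]] to the
    value at [x]. Since [1 < p], both exponents in that derivative are positive, so it is continuous
    up to 0. *)
Lemma integral_gamma_integrandS p x : 1 < p -> 0 < x ->
  ((gamma_integrand p x)%:E + \int[mu]_(t in `]0%R, x]) (gamma_integrand p t)%:E
   = p%:E * \int[mu]_(t in `]0%R, x]) (gamma_integrand (p - 1) t)%:E)%E.
Proof.
move=> p1 x0.
have p0 : 0 < p by lra.
have c1 : {within `[0, x], continuous (gamma_integrand (p - 1))}.
  by apply: within_continuous_gamma_integrand; rewrite ?subr_gt0.
have c2 := within_continuous_gamma_integrand p x p0 x0.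
have ci q : {within `[0, x], continuous (gamma_integrand q)} ->
    mu.-integrable `[0, x] (EFin \o gamma_integrand q).
  by move=> ?; apply: continuous_compact_integrable => //; exact: segment_compact.
have FTC : (\int[mu]_(t in `[0%R, x])
    (p * gamma_integrand (p - 1) t - gamma_integrand p t)%:E
    = (gamma_integrand p x)%:E)%E.
  rewrite (@continuous_FTC2 R _ (gamma_integrand p) 0 x x0).
  - by rewrite [gamma_integrand p 0]/gamma_integrand powR0 ?gt_eqF// mul0r sube0.
  - move=> z; apply: cvgB; last exact: c2.
    by apply: cvgM; [exact: cvg_cst|exact: c1].
  - move/(continuous_within_itvP _ x0) : c2 => [_ c2l c2r]; split => //.
    move=> t; rewrite in_itv/= => /andP[t0 _].
    by have [] := is_derive_gamma_integrand p t t0.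
  - move=> t; rewrite in_itv/= => /andP[t0 _]; rewrite derive1E.
    by have [_ ->] := is_derive_gamma_integrand p t t0.
rewrite !integral_itv_obnd_cbnd;
  do ?[apply/measurable_EFinP; exact: measurable_gamma_integrand].
rewrite -integralZl//; last exact: ci.
rewrite -FTC; under [in LHS]eq_integral do rewrite EFinB EFinM.
rewrite integralB//.
- by rewrite subeK// integrable_fin_num//; exact: ci.
- by apply: integrableZl => //; exact: ci.
- exact: ci.
Qed.

Let measurable_expR_half (D : set R) :
  measurable_fun D (fun t : R => expR (- (t / 2))).
Proof.
apply: (measurable_funS measurableT) => //.
apply: measurableT_comp => //; apply: measurable_funN.
exact: measurable_funM.
Qed.

Lemma integral_expRN_half_lty :
  (\int[mu]_(t in `]0%R, +oo[) (expR (- (t / 2)))%:E < +oo)%E.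
Proof.
have half0 : 0 < 2^-1 :> R by rewrite invr_gt0.
have mpdf : measurable_fun setT (fun t : R => (exponential_pdf 2^-1 t)%:E).
  by apply/measurable_EFinP; exact: measurable_exponential_pdf.
rewrite integral_mkcond.
(* The exponential law of rate 1/2 has density half of [expR (- (t / 2))], hence the factor 2. *)
apply: (@le_lt_trans _ _ (\int[mu]_t (2%:E * (exponential_pdf 2^-1 t)%:E))%E).
  apply: ge0_le_integral => //.
  - by move=> t _; apply: erestrict_ge0 => u _; rewrite lee_fin expR_ge0.
  - apply/(measurable_restrictT _ _).1 => //; apply/measurable_EFinP.
    exact: measurable_expR_half.
  - exact: measurable_funeM.
  - move=> t _; rewrite patchE; case: ifPn => [|_]; last first.
      by rewrite mule_ge0// lee_fin exponential_pdf_ge0 ?ltW.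
    rewrite inE/= in_itv/= andbT => t0.
    rewrite exponential_pdfE; last exact: ltW.
    rewrite -EFinM lee_fin mulrA divff// mul1r.
    by rewrite mulNr [_ * t]mulrC.
rewrite ge0_integralZl_EFin//.
  by rewrite integral_exponential_pdf// mule1 ltry.
by move=> t _; rewrite lee_fin exponential_pdf_ge0 ?ltW.
Qed.

Lemma integral_gamma_integrand_lty p : 0 < p ->
  (\int[mu]_(t in `]0%R, +oo[) (gamma_integrand p t)%:E < +oo)%E.
Proof.
move=> p0.
apply: (@le_lt_trans _ _ (\int[mu]_(t in `]0%R, +oo[)
  (((2 * p) `^ p)%:E * (expR (- (t / 2)))%:E))%E).
  apply: ge0_le_integral => //.
  - by move=> t _; rewrite lee_fin gamma_integrand_ge0.
  - by apply/measurable_EFinP; exact: measurable_gamma_integrand.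
  - apply: emeasurable_funM => //; apply/measurable_EFinP; exact: measurable_expR_half.
  - move=> t; rewrite /= in_itv/= andbT => t0.
    by rewrite -EFinM lee_fin le_powR_expR// ltW.
rewrite ge0_integralZl_EFin ?powR_ge0//.
- by rewrite lte_mul_pinfty ?lee_fin ?powR_ge0// integral_expRN_half_lty.
- by apply/measurable_EFinP; exact: measurable_expR_half.
Qed.

Lemma gamma_integrand_cvgy p : 0 < p -> gamma_integrand p x @[x --> +oo] --> 0.
Proof.
move=> p0.
apply: (@squeeze_cvgr _ _ _ _ (cst 0) (fun x => (2 * p) `^ p * expR (- (x / 2)))).
- near=> x.
  have x0 : 0 <= x by near: x; apply: nbhs_pinfty_ge.
  by rewrite gamma_integrand_ge0 le_powR_expR.
- exact: cvg_cst.
- rewrite -[X in _ --> X](mulr0 ((2 * p) `^ p)).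
  apply: cvgM; first exact: cvg_cst.
  apply: (@cvg_comp _ _ _ (fun x : R => x / 2) (fun y => expR (- y)) _ +oo).
    by apply: gt0_cvgMly; [rewrite invr_gt0|exact: cvg_id].
  exact: cvgr_expR.
Unshelve. all: by end_near. Qed.

(** [Gamma] is a real integral, which would take a default value if it diverged; for [1 < s]
    finiteness makes it equal to the extended one. *)
Lemma GammaE s : 1 < s ->
  (Gamma s)%:E = (\int[mu]_(t in `]0%R, +oo[) (gamma_integrand (s - 1) t)%:E)%E.
Proof.
move=> s1; rewrite fineK// ge0_fin_numE.
  by apply: integral_gamma_integrand_lty; rewrite subr_gt0.
by apply: integral_ge0 => t _; rewrite lee_fin gamma_integrand_ge0.
Qed.

Lemma Gamma_ge0 s : 0 <= Gamma s.
Proof. by apply: Rintegral_ge0 => t _; exact: gamma_integrand_ge0. Qed.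

Lemma Gamma_gt0 s : 1 < s -> 0 < Gamma s.
Proof.
move=> s1; rewrite -lte_fin GammaE//.
have mg D : measurable_fun D (fun t : R => (gamma_integrand (s - 1) t)%:E).
  by apply/measurable_EFinP; exact: measurable_gamma_integrand.
have g0 D t : D t -> (0 <= (gamma_integrand (s - 1) t)%:E)%E.
  by rewrite lee_fin gamma_integrand_ge0.
apply: (@lt_le_trans _ _ (\int[mu]_(t in `[1%R, 2%R]) (expR (- 2))%:E)%E).
  rewrite integral_cst//= lebesgue_measure_itv/= lte_fin ltr1n -EFinB -EFinM.
  by rewrite lte_fin mulr_gt0 ?expR_gt0//; lra.
apply: (@le_trans _ _
    (\int[mu]_(t in `[1%R, 2%R]) (gamma_integrand (s - 1) t)%:E)%E).
  apply: ge0_le_integral => //.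
  - exact: mg.
  - move=> t; rewrite /= in_itv/= => /andP[t1 t2]; rewrite lee_fin.
    rewrite -[leLHS]mul1r ler_pM ?expR_ge0//; last by rewrite ler_expR lerN2.
    by rewrite -[leLHS](powRr0 t) ler_powR// subr_ge0 ltW.
apply: ge0_subset_integral => //; first exact: mg.
  exact: g0.
by move=> t; rewrite /= !in_itv/= andbT => /andP[t1 _]; rewrite (lt_le_trans _ t1).
Qed.

(** Integration by parts with exponent [s] on []0, n + 1]], then [n] to infinity: the boundary term
    vanishes and the integrals increase to those over the half-line. *)
Lemma GammaS s : 1 < s -> Gamma (s + 1) = s * Gamma s.
Proof.
move=> s1; apply: EFin_inj; rewrite EFinM !GammaE//; last by rewrite ltrDr; lra.
rewrite addrK.
have lim q : (\int[mu]_(t in `]0%R, n.+1%:R]) (gamma_integrand q t)%:E)%E @[n --> \oo] -->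
    (\int[mu]_(t in `]0%R, +oo[) (gamma_integrand q t)%:E)%E.
  have -> : `]0, +oo[%classic = \bigcup_n `]0, (n.+1%:R : R)]%classic.
    apply/seteqP; split => t.
      rewrite /= in_itv/= andbT => t0; exists (Num.truncn t) => //=.
      by rewrite in_itv/= t0/= ltW// truncnS_gt.
    by move=> [n _]; rewrite /= !in_itv/= andbT => /andP[].
  apply: ge0_nondecreasing_set_cvg_integral => //.
  - apply/nondecreasing_seqP => n; apply/subsetPset => t/=.
    rewrite !in_itv/= => /andP[-> /le_trans]; apply.
    by rewrite ler_nat.
  - by move=> n; apply/measurable_EFinP; exact: measurable_gamma_integrand.
  - by move=> n t _; rewrite lee_fin gamma_integrand_ge0.
have limF : (gamma_integrand s n.+1%:R)%:E @[n --> \oo] --> 0%E.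
  apply: cvg_EFin; first by near=> n.
  have cvgS : (n.+1%:R : R) @[n --> \oo] --> +oo.
    by rewrite (cvg_shiftS (fun n => n%:R : R)); exact: cvgr_idn.
  by apply: (cvg_comp _ _ cvgS); apply: gamma_integrand_cvgy; lra.
have lims := @cvgeD _ _ _ _ _ _ _ _ (fin_num_adde_defr _ (isT : 0%E \is a fin_num)) limF (lim s).
rewrite add0e in lims.
suff limZ : ((gamma_integrand s n.+1%:R)%:E + \int[mu]_(t in `]0%R, n.+1%:R])
    (gamma_integrand s t)%:E)%E @[n --> \oo] -->
    (s%:E * \int[mu]_(t in `]0%R, +oo[) (gamma_integrand (s - 1) t)%:E)%E.
  exact: (cvg_unique (@ereal_hausdorff R) (lims _) limZ).
under [X in X @ _ --> _]eq_fun do rewrite integral_gamma_integrandS// ?ltr0n//.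
exact: cvgeZl.
Unshelve. all: by end_near. Qed.

End gamma_integrand.

(** * Tonelli's theorem on rectangles *)

Section tonelli_on.
Context {R : realType}.
Local Notation mu := (@lebesgue_measure R).
Variables (f : R * R -> \bar R).
Hypothesis mf : measurable_fun [set: R * R] f.
Hypothesis f0 : forall z, (0 <= f z)%E.

Lemma measurable_fun_integral_on (D : set R) : measurable D ->
  measurable_fun [set: R] (fun x : R => \int[mu]_(y in D) f (x, y))%E.
Proof.
move=> mD.
(* The inner domain is turned into an extension of [f] by zero, so that the inner integral runs over
   the whole line. *)
rewrite (_ : (fun x => _) = fubini_F mu (f \_ (setT `*` D))).
  apply: measurable_fun_fubini_tonelli_F.
    apply/(measurable_restrictT _ _).1; first exact: measurableX.
    exact: measurable_funS mf.
  by move=> z; exact: erestrict_ge0.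
apply/funext => x; rewrite /fubini_F [LHS]integral_mkcond.
apply: eq_integral => y _; rewrite !patchE.
by congr (if _ then _ else _); apply/idP/idP; rewrite !inE//= => -[].
Qed.

Lemma tonelli_on (D1 D2 : set R) : measurable D1 -> measurable D2 ->
  (\int[mu]_(x in D1) \int[mu]_(y in D2) f (x, y)
   = \int[mu]_(y in D2) \int[mu]_(x in D1) f (x, y))%E.
Proof.
move=> mD1 mD2.
have mfD : measurable_fun [set: R * R] (f \_ (D1 `*` D2)).
  apply/(measurable_restrictT _ _).1; first exact: measurableX.
  exact: measurable_funS mf.
have fD0 z : (0 <= (f \_ (D1 `*` D2)) z)%E by exact: erestrict_ge0.
have := @fubini_tonelli _ _ _ _ _ mu mu _ mfD fD0.
congr (_ = _).
- rewrite [RHS]integral_mkcond; apply: eq_integral => x _.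
  rewrite [RHS]patchE; case: ifPn => xD.
    rewrite [RHS]integral_mkcond; apply: eq_integral => y _; rewrite !patchE.
    congr (if _ then _ else _); apply/idP/idP; rewrite !inE/=; first by case.
    by split => //; exact: set_mem.
  rewrite integral0_eq// => y _; rewrite patchE ifF//; apply/negP.
  by rewrite inE => -[] /= /mem_set; rewrite (negbTE xD).
- rewrite [RHS]integral_mkcond; apply: eq_integral => y _.
  rewrite [RHS]patchE; case: ifPn => yD.
    rewrite [RHS]integral_mkcond; apply: eq_integral => x _; rewrite !patchE.
    congr (if _ then _ else _); apply/idP/idP; rewrite !inE/=; first by case.
    by split => //; exact: set_mem.
  rewrite integral0_eq// => x _; rewrite patchE ifF//; apply/negP.
  by rewrite inE => -[] /= _ /mem_set; rewrite (negbTE yD).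
Qed.

End tonelli_on.

(** * Gamma densities, and the kernel as their integral over all shapes *)

(** The guard extends the density by zero off the open quadrant, so that each variable can be
    integrated over the whole line. *)
Definition gamma_density {R : realType} (s t : R) : R :=
  if (0 < s) && (0 < t) then gamma_integrand (s - 1) t / Gamma s else 0.

Section gamma_density.
Context {R : realType}.
Local Notation mu := (@lebesgue_measure R).
Implicit Types s t x : R.

Lemma gamma_density_ge0 s t : 0 <= gamma_density s t.
Proof.
rewrite /gamma_density; case: ifP => // _.
by rewrite divr_ge0 ?gamma_integrand_ge0 ?Gamma_ge0.
Qed.

(** For [t > 0] this is the integrand of [Gamma], in a form built from [expR] and [ln] and hence
    jointly measurable on the whole plane. *)
Let expg (z : R * R) : R := expR ((z.1 - 1) * ln z.2 - z.2).

Let measurable_expg : measurable_fun [set: R * R] expg.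
Proof.
apply: measurableT_comp => //; apply: measurable_funB => //.
apply: measurable_funM; first by apply: measurable_funB.
by apply: measurableT_comp => //; exact: measurable_ln.
Qed.

Let gamma_integrandE s t : 0 < t -> gamma_integrand (s - 1) t = expg (s, t).
Proof. by move=> t0; rewrite /gamma_integrand /powR gt_eqF// -expRD. Qed.

Lemma measurable_Gamma : measurable_fun [set: R] (@Gamma R).
Proof.
rewrite (_ : @Gamma R =
    fine \o (fun s => \int[mu]_(t in `]0%R, +oo[) (expg (s, t))%:E)%E).
  apply: measurableT_comp; first exact: fine_measurable.
  apply: (@measurable_fun_integral_on _ (EFin \o expg)) => //.
    exact/measurable_EFinP.
  by move=> z; rewrite lee_fin expR_ge0.
apply/funext => s/=; congr fine; apply: eq_integral => t.
by rewrite inE/= in_itv/= andbT => t0; rewrite -gamma_integrandE.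
Qed.

Lemma measurable_gamma_density :
  measurable_fun [set: R * R] (fun z => gamma_density z.1 z.2).
Proof.
rewrite (_ : (fun z => _) = fun z : R * R => if (0 < z.1) && (0 < z.2) then
    expg z * (Gamma z.1) `^ (-1) else 0); last first.
  apply/funext => -[s t]; rewrite /gamma_density/=; case: ifP => // /andP[_ t0].
  by rewrite gamma_integrandE// powR_inv1 ?Gamma_ge0.
apply: measurable_fun_ifT => //.
  by apply: measurable_and; apply: measurable_fun_ltr.
apply: measurable_funM => //.
apply: (measurableT_comp (measurable_powR (-1))).
by apply: (measurableT_comp measurable_Gamma).
Qed.

Lemma measurable_gamma_densityl t : measurable_fun [set: R] (gamma_density ^~ t).
Proof. exact: measurable_fun_pair1 measurable_gamma_density. Qed.

Lemma measurable_gamma_densityr s : measurable_fun [set: R] (gamma_density s).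
Proof. exact: measurable_fun_pair2 measurable_gamma_density. Qed.

Lemma kernelSE t : 0 < t -> kernelS t = fine (\int[mu]_s (gamma_density s t)%:E)%E.
Proof.
move=> t0; rewrite /kernelS /Rintegral.
have mkernel : measurable_fun (`]0, +oo[ : set R) (fun s : R => (t `^ (s - 1) / Gamma s)%:E).
  apply: measurable_funTS; apply/measurable_EFinP.
  rewrite (_ : (fun s => _) = fun s => t `^ (s - 1) * Gamma s `^ (-1)); last first.
    by apply/funext => s; rewrite powR_inv1 ?Gamma_ge0.
  apply: measurable_funM.
    by apply: (measurableT_comp (measurable_powRr t)); exact: measurable_funB.
  exact: (measurableT_comp (measurable_powR (-1)) measurable_Gamma).
have kernel_ge0 s : (0 <= (t `^ (s - 1) / Gamma s)%:E)%E.
  by rewrite lee_fin divr_ge0 ?powR_ge0 ?Gamma_ge0.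
transitivity (fine ((expR (- t))%:E *
    \int[mu]_(s in `]0%R, +oo[) (t `^ (s - 1) / Gamma s)%:E))%E.
  have : (0 <= \int[mu]_(s in `]0%R, +oo[) (t `^ (s - 1) / Gamma s)%:E)%E.
    exact: integral_ge0.
  (* If the integral over the shapes diverges, a positive factor keeps it infinite, and both sides
     take the default value 0. *)
  case: (integral _ _ _) => [r||]//= _.
  by rewrite gt0_muley ?lte_fin ?expR_gt0//= mulr0.
rewrite -ge0_integralZl_EFin ?expR_ge0//.
congr fine; rewrite integral_mkcond; apply: eq_integral => s _.
rewrite patchE /gamma_density t0 andbT.
have -> : (s \in `]0, +oo[%classic) = (0 < s).
  by apply/idP/idP; rewrite inE/= in_itv/= andbT.
by case: ifP => // _; rewrite -EFinM /gamma_integrand mulrCA mulrA.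
Qed.

Lemma integral_gamma_density_on s : 0 < s ->
  (\int[mu]_t (gamma_density s t)%:E = \int[mu]_(t in `]0%R, +oo[)
    ((Gamma s)^-1%:E * (gamma_integrand (s - 1) t)%:E))%E.
Proof.
move=> s0; rewrite [RHS]integral_mkcond; apply: eq_integral => t _.
rewrite patchE /gamma_density s0/=.
have -> : (t \in `]0, +oo[%classic) = (0 < t).
  by apply/idP/idP; rewrite inE/= in_itv/= andbT.
by case: ifP => // _; rewrite mulrC.
Qed.

(** A bound only, because finiteness of the Gamma integral is at hand just for [1 < s]: were it
    infinite, [Gamma s] and its inverse would be 0, and so would the integral. This suffices for the
    shapes in []0, 2]]. *)
Lemma integral_gamma_density_le1 s : (\int[mu]_t (gamma_density s t)%:E <= 1)%E.
Proof.
have [s0|s0] := leP s 0.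
  rewrite integral0_eq// => t _.
  by rewrite /gamma_density ltNge s0.
rewrite integral_gamma_density_on// ge0_integralZl_EFin ?invr_ge0 ?Gamma_ge0//; last 2 first.
- by move=> t _; rewrite lee_fin gamma_integrand_ge0.
- by apply/measurable_EFinP; exact: measurable_gamma_integrand.
rewrite /Gamma /Rintegral -/(gamma_integrand _ _).
set I := integral _ _ _.
have : (0 <= I)%E by apply: integral_ge0 => t _; rewrite lee_fin gamma_integrand_ge0.
case: I => [r||]//=; last by rewrite invr0 mul0e.
rewrite lee_fin -EFinM lee_fin => r0.
have [->|rn0] := eqVneq r 0; first by rewrite mulr0.
by rewrite mulVf.
Qed.

Lemma integral_gamma_density s : 1 < s -> (\int[mu]_t (gamma_density s t)%:E = 1)%E.
Proof.
move=> s1; have s0 : 0 < s by lra.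
rewrite integral_gamma_density_on// ge0_integralZl_EFin ?invr_ge0 ?Gamma_ge0//; last 2 first.
- by move=> t _; rewrite lee_fin gamma_integrand_ge0.
- by apply/measurable_EFinP; exact: measurable_gamma_integrand.
by rewrite -GammaE// -EFinM mulVf// gt_eqF// Gamma_gt0.
Qed.

(** A form of the functional equation of [Gamma]. It gives the mean [s] of the density, and the
    decay in the shape on bounded intervals. *)
Lemma gamma_densityM s t : 1 < s ->
  t * gamma_density s t = s * gamma_density (s + 1) t.
Proof.
move=> s1; have s0 : 0 < s by lra.
have s10 : 0 < s + 1 by lra.
rewrite /gamma_density s0 s10/=; case: ifPn => [t0|]; last by rewrite !mulr0.
rewrite GammaS// addrK /gamma_integrand -(mulr_powRB1 (ltW t0) s0).
by field; rewrite !gt_eqF// Gamma_gt0.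
Qed.

(** Integration by parts with exponent [s], divided by [Gamma (s + 1)]. In terms of distribution
    functions, h_(s+1)(x) + P(s+1,x) = P(s,x). *)
Lemma gamma_densityS s x : 1 < s -> 0 < x ->
  ((gamma_density (s + 1) x)%:E
     + \int[mu]_(t in `]0%R, x]) (gamma_density (s + 1) t)%:E
   = \int[mu]_(t in `]0%R, x]) (gamma_density s t)%:E)%E.
Proof.
move=> s1 x0; have s0 : 0 < s by lra.
have s10 : 0 < s + 1 by lra.
have G0 : (0 <= ((Gamma (s + 1))^-1)%:E)%E by rewrite lee_fin invr_ge0 Gamma_ge0.
have E u : 0 < u -> (\int[mu]_(t in `]0%R, x]) (gamma_density u t)%:E
    = ((Gamma u)^-1)%:E * \int[mu]_(t in `]0%R, x]) (gamma_integrand (u - 1) t)%:E)%E.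
  move=> u0; rewrite -ge0_integralZl_EFin ?invr_ge0 ?Gamma_ge0//; last 2 first.
  - by move=> t _; rewrite lee_fin gamma_integrand_ge0.
  - by apply/measurable_EFinP; exact: measurable_gamma_integrand.
  apply: eq_integral => t; rewrite inE/= in_itv/= => /andP[t0 _].
  by rewrite /gamma_density u0 t0/= mulrC.
rewrite !E// addrK.
rewrite [gamma_density _ x]/gamma_density s10 x0/= addrK mulrC EFinM.
rewrite -ge0_muleDr ?lee_fin ?gamma_integrand_ge0//; last first.
  by apply: integral_ge0 => t _; rewrite lee_fin gamma_integrand_ge0.
rewrite integral_gamma_integrandS// muleA -EFinM GammaS//; congr (_%:E * _)%E.
by field; rewrite !gt_eqF// Gamma_gt0.
Qed.

End gamma_density.

(** * Averages of the densities over unit intervals of shapes *)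

(** These are the unit slices of the integral over shapes. They start above shape 1, where the
    recurrence holds, and the domain []1, 2]] stays fixed so that passing from [n] to [n + 1] is
    pointwise in [s]. *)
Definition gamma_mix {R : realType} (n : nat) (t : R) : \bar R :=
  (\int[@lebesgue_measure R]_(s in `]1%R, 2%R])
    (gamma_density ((s : R) + n%:R) t)%:E)%E.

Section gamma_mix.
Context {R : realType}.
Local Notation mu := (@lebesgue_measure R).
Implicit Types (s t x : R) (n : nat).

Let dens n (z : R * R) : \bar R := (gamma_density (z.2 + n%:R) z.1)%:E.

Let dens_ge0 n z : (0 <= dens n z)%E.
Proof. by rewrite lee_fin gamma_density_ge0. Qed.

Let measurable_dens n : measurable_fun [set: R * R] (dens n).
Proof.
apply/measurable_EFinP.
apply: (measurableT_comp measurable_gamma_density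
  (_ : measurable_fun setT (fun z : R * R => (z.2 + n%:R, z.1)))).
by apply: measurable_fun_pair => //; exact: measurable_funD.
Qed.

Let measurable_dens1 n s : measurable_fun [set: R] (fun t => dens n (t, s)).
Proof. exact: measurable_fun_pair1 (measurable_dens n). Qed.

Let measurable_dens2 n t : measurable_fun [set: R] (fun s => dens n (t, s)).
Proof. exact: measurable_fun_pair2 (measurable_dens n). Qed.

Lemma gamma_mix_ge0 n t : (0 <= gamma_mix n t)%E.
Proof. by apply: integral_ge0 => s _; exact: dens_ge0 (t, _). Qed.

Lemma measurable_gamma_mix n : measurable_fun [set: R] (@gamma_mix R n).
Proof. exact: (measurable_fun_integral_on _ (measurable_dens n) (dens_ge0 n)). Qed.

Let length12 : lebesgue_measure (`]1, 2] : set R) = 1%E.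
Proof.
rewrite lebesgue_measure_itv/= lte_fin ltr1n -EFinB; congr EFin.
lra.
Qed.

Lemma integral_gamma_mix n (D : set R) : measurable D ->
  (\int[mu]_(t in D) gamma_mix n t =
   \int[mu]_(s in `]1%R, 2%R]) \int[mu]_(t in D)
     (gamma_density ((s : R) + n%:R) t)%:E)%E.
Proof. by move=> mD; exact: (tonelli_on _ (measurable_dens n) (dens_ge0 n)). Qed.

(** The telescoping relation: [gamma_densityS] at shape [s + n], averaged over [s]. *)
Lemma gamma_mixS n x : 0 < x ->
  (gamma_mix n.+1 x + \int[mu]_(t in `]0%R, x]) gamma_mix n.+1 t
   = \int[mu]_(t in `]0%R, x]) gamma_mix n t)%E.
Proof.
move=> x0; have mI : measurable (`]0, x] : set R) by [].
rewrite [in RHS](integral_gamma_mix n _ mI).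
rewrite [X in (_ + X)%E](integral_gamma_mix n.+1 _ mI).
rewrite /gamma_mix.
transitivity (\int[mu]_(s in `]1%R, 2%R]) ((gamma_density (s + n.+1%:R) x)%:E +
    \int[mu]_(t in `]0%R, x]) (gamma_density (s + n.+1%:R) t)%:E))%E; last first.
  apply: eq_integral => s; rewrite inE/= in_itv/= => /andP[s1 _].
  have sn1 : 1 < s + n%:R by rewrite (lt_le_trans s1)// lerDl.
  by have := gamma_densityS _ _ sn1 x0; rewrite -addrA natr1.
apply/esym; apply: ge0_integralD.
- by [].
- by move=> s _; rewrite lee_fin gamma_density_ge0.
- by apply: measurable_funTS; exact: (measurable_dens2 n.+1 x).
- by move=> s _; apply: integral_ge0 => t _; rewrite lee_fin gamma_density_ge0.
- apply: measurable_funTS.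
  apply: (measurable_fun_integral_on (fun z => dens n.+1 (z.2, z.1))) => //.
  by apply: (measurableT_comp (measurable_dens n.+1)); exact: measurable_swap.
Qed.

(** For [t <= x], h_(s+n+1)(t) = t/(s+n) h_(s+n)(t) is at most x/(n+1) h_(s+n)(t), and h_(s+n) has
    mass 1. This crude rate already makes the remainder of the telescoping sum vanish. *)
Lemma integral_gamma_mix_le n x : 0 < x ->
  (\int[mu]_(t in `]0%R, x]) gamma_mix n.+1 t <= (x / n.+1%:R)%:E)%E.
Proof.
move=> x0; rewrite integral_gamma_mix//.
apply: (@le_trans _ _ (\int[mu]_(s in `]1%R, 2%R]) (x / n.+1%:R)%:E)%E); last first.
  by rewrite integral_cst//= length12 mule1.
apply: ge0_le_integral => //.
- by move=> s _; apply: integral_ge0 => t _; rewrite lee_fin gamma_density_ge0.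
- apply: measurable_funTS.
  apply: (measurable_fun_integral_on (fun z => dens n.+1 (z.2, z.1))) => //.
  by apply: (measurableT_comp (measurable_dens n.+1)); exact: measurable_swap.
move=> s; rewrite /= in_itv/= => /andP[s1 _].
have sn1 : 1 < s + n%:R by rewrite (lt_le_trans s1)// lerDl.
have ns : n.+1%:R <= s + n%:R by rewrite -natr1 addrC lerD2r ltW.
have xn0 : 0 <= x / n.+1%:R by rewrite divr_ge0// ltW.
apply: (@le_trans _ _ (\int[mu]_(t in `]0%R, x])
    ((x / n.+1%:R)%:E * (gamma_density (s + n%:R) t)%:E)))%E.
  apply: ge0_le_integral => //.
  - by move=> t _; rewrite lee_fin gamma_density_ge0.
  - by apply: measurable_funTS; exact: (measurable_dens1 n.+1 s).
  - apply: measurable_funTS; apply: measurable_funeM.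
    exact: (measurable_dens1 n s).
  - move=> t; rewrite /= in_itv/= => /andP[t0 tx].
    rewrite -EFinM lee_fin -natr1 addrA.
    have sn0 : 0 < s + n%:R by lra.
    have -> : gamma_density (s + n%:R + 1) t
        = t / (s + n%:R) * gamma_density (s + n%:R) t.
      by rewrite mulrAC gamma_densityM// mulrC mulrA mulVf ?mul1r// gt_eqF.
    rewrite ler_wpM2r ?gamma_density_ge0// ler_pM ?invr_ge0 ?(ltW t0) ?(ltW sn0)//.
    by rewrite natr1 lef_pV2 ?posrE.
rewrite ge0_integralZl_EFin//; last 2 first.
- by move=> t _; rewrite lee_fin gamma_density_ge0.
- by apply: measurable_funTS; exact: (measurable_dens1 n s).
rewrite -[leRHS]mule1 lee_wpmul2l ?lee_fin//.
rewrite -(integral_gamma_density _ sn1); apply: ge0_subset_integral => //.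
- exact: (measurable_dens1 n s).
- by move=> t _; rewrite lee_fin gamma_density_ge0.
Qed.

(** By [gamma_mixS] the sum telescopes: its partial sums are [B 0 - B N], and [B N] tends to 0. *)
Lemma nneseries_gamma_mix x : 0 < x ->
  (\sum_(n <oo) gamma_mix n.+1 x = \int[mu]_(t in `]0%R, x]) gamma_mix 0 t)%E.
Proof.
move=> x0.
pose B n := (\int[mu]_(t in `]0%R, x]) gamma_mix n t)%E.
have B0 n : (0 <= B n)%E by apply: integral_ge0 => t _; exact: gamma_mix_ge0.
have Bfin n : B n.+1 \is a fin_num.
  by rewrite ge0_fin_numE// (le_lt_trans (integral_gamma_mix_le n x x0))// ltry.
have mixS n : (gamma_mix n.+1 x + B n.+1 = B n)%E := gamma_mixS n x x0.
have sumB N : (\sum_(0 <= i < N) gamma_mix i.+1 x + B N = B 0%N)%E.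
  elim: N => [|N IH]; first by rewrite big_geq// add0e.
  rewrite big_nat_recr; last exact: leq0n.
  rewrite -addeA [X in (_ + X)%E]mixS.
  exact: IH.
have limB : B n.+1 @[n --> \oo] --> 0%E.
  apply: (@squeeze_cvge _ _ _ _ (cst 0%E) _ (fun n => (x / n.+1%:R)%:E)).
  - by apply: nearW => n; rewrite B0 integral_gamma_mix_le.
  - exact: cvg_cst.
  - apply: cvg_EFin; first by apply: nearW.
    rewrite -[X in _ --> X](mulr0 x); apply: cvgM; first exact: cvg_cst.
    exact: cvg_harmonic.
apply/cvg_lim => //.
(* The index is shifted by one: cancelling [B N] requires it to be finite, which [Bfin] gives for
   positive indices. *)
rewrite -(cvg_shiftS (fun N => \sum_(0 <= i < N) gamma_mix i.+1 x)%E).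
rewrite (_ : (fun N => _) = fun N => (B 0%N - B N.+1)%E); last first.
  by apply/funext => N; rewrite -(sumB N.+1) addeK.
have : (B 0%N - B n.+1)%E @[n --> \oo] --> (B 0%N - 0)%E.
  by apply: cvgeB limB; [rewrite fin_num_adde_defl|exact: cvg_cst].
by rewrite sube0.
Qed.

End gamma_mix.

(** * Integrability of S - 1 over the half-line *)

Section kernel.
Context {R : realType}.
Local Notation mu := (@lebesgue_measure R).
Implicit Types (s t x : R) (n : nat).

Let dens (z : R * R) : \bar R := (gamma_density z.2 z.1)%:E.

Let dens_ge0 z : (0 <= dens z)%E.
Proof. by rewrite lee_fin gamma_density_ge0. Qed.

Let measurable_dens : measurable_fun [set: R * R] dens.
Proof.
apply/measurable_EFinP.
apply: (measurableT_comp measurable_gamma_density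
  (_ : measurable_fun setT (fun z : R * R => (z.2, z.1)))).
exact: measurable_swap.
Qed.

Let measurable_densl t : measurable_fun [set: R] (fun s => (gamma_density s t)%:E).
Proof. by apply/measurable_EFinP; exact: measurable_gamma_densityl. Qed.

Let measurable_densr s : measurable_fun [set: R] (fun t => (gamma_density s t)%:E).
Proof. by apply/measurable_EFinP; exact: measurable_gamma_densityr. Qed.

(** Translation of the shape by [n] identifies the averages with consecutive slices of the integral
    over shapes. *)
Lemma gamma_mix_shift n t :
  (gamma_mix n t = \int[mu]_(s in `]n.+1%:R, n.+2%:R]) (gamma_density s t)%:E)%E.
Proof.
pose g := (fun s : R => (gamma_density s t)%:E) \_ `]n.+1%:R, n.+2%:R].
have mg : measurable_fun [set: R] g.
  apply/(measurable_restrictT _ _).1; first exact: measurable_itv.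
  exact: (measurable_funTS (measurable_densl t)).
have g0 s : (0 <= g s)%E.
  by apply: erestrict_ge0 => u _; rewrite lee_fin gamma_density_ge0.
have := ge0_integral_affine 1 (- n%:R) g ltr01 mg g0.
rewrite mul1e => shift.
rewrite [RHS]integral_mkcond -[RHS]shift /gamma_mix [LHS]integral_mkcond.
apply: eq_integral => s _; rewrite opprK divr1 /g !patchE.
congr (if _ then _ else _).
apply/idP/idP; rewrite !inE/= !in_itv/= -!natr1 => /andP[? ?]; apply/andP; split; lra.
Qed.

(** Shapes up to 2 are kept apart. The slices []n + 2, n + 3]] are the [gamma_mix n.+1], whose sum
    telescopes to the integral of P(s,t) over [s] in []1, 2]]. *)
Lemma integral_gamma_density_shape t : 0 < t ->
  (\int[mu]_s (gamma_density s t)%:E =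
   \int[mu]_(s in `]0%R, 2%R]) (gamma_density s t)%:E +
   \int[mu]_(u in `]0%R, t]) gamma_mix 0 u)%E.
Proof.
move=> t0; rewrite -[X in (_ = _ + X)%E]nneseries_gamma_mix//.
have -> : (\int[mu]_s (gamma_density s t)%:E =
    \int[mu]_(s in `]0%R, +oo[) (gamma_density s t)%:E)%E.
  rewrite [RHS]integral_mkcond; apply: eq_integral => s _.
  rewrite patchE; case: ifPn => //.
  rewrite notin_setE/= in_itv/= andbT => /negP/negbTE s0.
  by rewrite /gamma_density s0.
have -> : `]0, +oo[%classic = `]0, 2] `|` \bigcup_n `]n.+2%:R, (n.+3%:R : R)]%classic.
  apply/seteqP; split => s.
    rewrite /= in_itv/= andbT => s0.
    have [s2|s2] := leP s 2; first by left; rewrite /= in_itv/= s0.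
    right.
    have exn : exists n, s <= n%:R.
      by exists (Num.truncn s).+1; exact/ltW/truncnS_gt.
    (* The least natural number not below [s] is at least 3 because [s > 2]; it is the right end of
       the slice containing [s]. *)
    case: (ex_minnP exn) => -[|[|[|n]]] sn minn.
    - by have := lt_le_trans s2 sn; rewrite ltNge ler0n.
    - by have := lt_le_trans s2 sn; rewrite ltr_nat.
    - by have := lt_le_trans s2 sn; rewrite ltr_nat.
    exists n => //=; rewrite in_itv/= sn andbT ltNge; apply/negP => sn2.
    by have := minn _ sn2; rewrite ltnn.
  move=> [|[n _]]; rewrite /= !in_itv/= andbT => /andP[+ _]; first by [].
  exact/lt_trans/ltr0Sn.
have mbig : measurable (\bigcup_n `]n.+2%:R, (n.+3%:R : R)]%classic).
  by apply: bigcup_measurable.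
have g0 s : (0 <= (gamma_density s t)%:E)%E by rewrite lee_fin gamma_density_ge0.
have mg D : measurable_fun D (fun s => (gamma_density s t)%:E).
  exact: (measurable_funTS (measurable_densl t)).
rewrite ge0_integral_setU; last 5 first.
- exact: measurable_itv.
- exact: mbig.
- exact: mg.
- by move=> s _; exact: g0.
- rewrite disj_set2E; apply/eqP/seteqP; split => // s [].
  rewrite /= in_itv/= => /andP[_ s2] [n _]; rewrite /= in_itv/= => /andP[ns _].
  by have := lt_le_trans ns s2; rewrite ltr_nat.
congr (_ + _)%E.
rewrite ge0_integral_bigcup; last 4 first.
- by move=> n; exact: measurable_itv.
- exact: mg.
- by move=> s _; exact: g0.
- apply: ltn_trivIset => m n mn; apply/seteqP; split => // s [].
  rewrite /= !in_itv/= => /andP[_ sm] /andP[ns _].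
  by have := lt_le_trans ns sm; rewrite ltr_nat !ltnS leqNgt mn.
by apply: eq_eseriesr => n _; rewrite gamma_mix_shift.
Qed.

Lemma integral_gamma_density_pos s : 1 < s ->
  (\int[mu]_(t in `]0%R, +oo[) (gamma_density s t)%:E = 1)%E.
Proof.
move=> s1; rewrite -(integral_gamma_density s s1) integral_mkcond.
apply: eq_integral => t _; rewrite patchE; case: ifPn => //.
rewrite notin_setE/= in_itv/= andbT => /negP/negbTE t0.
by rewrite /gamma_density t0 andbF.
Qed.

(** [gamma_mix 0] is a probability density, being an average of such. When 1 is replaced by this sum
    in S - 1, the distribution function cancels and only the tail is subtracted. *)
Lemma gamma_mix_cdfD_tail t : 0 < t ->
  (\int[mu]_(u in `]0%R, t]) gamma_mix 0 u
     + \int[mu]_(u in `]t, +oo[) gamma_mix 0 u = 1)%E.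
Proof.
move=> t0; have mm D : measurable_fun D (@gamma_mix R 0).
  exact: (measurable_funTS (measurable_gamma_mix 0)).
have m0 u : (0 <= @gamma_mix R 0 u)%E by exact: gamma_mix_ge0.
transitivity (\int[mu]_(u in `]0%R, t] `|` `]t, +oo[) gamma_mix 0 u)%E.
  apply/esym; apply: ge0_integral_setU.
  - exact: measurable_itv.
  - exact: measurable_itv.
  - exact: mm.
  - by move=> u _; exact: m0.
  - rewrite disj_set2E; apply/eqP/seteqP; split => // u [].
    by rewrite /= !in_itv/= andbT => /andP[_ ut] /(le_lt_trans ut); rewrite ltxx.
have -> : `]0, t] `|` `]t, +oo[ = (`]0, +oo[%classic : set R).
  apply/seteqP; split => u; rewrite /= !in_itv/= !andbT.
    by move=> [/andP[]//|]; exact: lt_trans.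
  by move=> u0; rewrite u0/=; have [ut|ut] := leP u t; [left|right].
have mI : measurable (`]0, +oo[ : set R) by exact: measurable_itv.
rewrite (integral_gamma_mix 0 _ mI).
transitivity (\int[mu]_(s in `]1%R, 2%R]) (1 : \bar R))%E.
  apply: eq_integral => s; rewrite inE/= in_itv/= => /andP[s1 _].
  by rewrite addr0; exact: integral_gamma_density_pos.
rewrite integral_cst; last exact: measurable_itv.
rewrite mul1e/= lebesgue_measure_itv/= lte_fin ltr1n -EFinB; congr EFin; lra.
Qed.

(** The constraint [t < u] is written into the integrand, so that the domain in Tonelli's theorem is
    a rectangle. *)
Let tail (z : R * R) : \bar R := if z.1 < z.2 then gamma_mix 0 z.2 else 0%E.

Let tail_ge0 z : (0 <= tail z)%E.
Proof. by rewrite /tail; case: ifP => // _; exact: gamma_mix_ge0. Qed.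

Let measurable_tail : measurable_fun [set: R * R] tail.
Proof.
apply: measurable_fun_ifT.
- by apply: measurable_fun_ltr.
- exact: (measurableT_comp (measurable_gamma_mix 0) measurable_snd).
- exact: measurable_cst.
Qed.

Let tailE t : 0 < t -> (\int[mu]_(u in `]t, +oo[) gamma_mix 0 u =
  \int[mu]_(u in `]0%R, +oo[) tail (t, u))%E.
Proof.
move=> t0; rewrite [LHS]integral_mkcond [RHS]integral_mkcond.
apply: eq_integral => u _; rewrite !patchE /tail/=.
have H (x : R) : (u \in `]x, +oo[%classic) = (x < u).
  by apply/idP/idP; rewrite inE/= in_itv/= andbT.
rewrite !H; have [tu|ut] := ltP t u; first by rewrite (lt_trans t0 tu).
by case: ifP.
Qed.

(** Exchanging the integrals over [t] and [u] turns the integrated tail into the mean of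
    [gamma_mix 0], that is, the average over [s] in []1, 2]] of the means [s] of h_s, each at most
    2. *)
Lemma integral_gamma_mix_tail :
  (\int[mu]_(t in `]0%R, +oo[) \int[mu]_(u in `]t, +oo[) gamma_mix 0 u <= 2%:E)%E.
Proof.
have mI : measurable (`]0, +oo[ : set R) by exact: measurable_itv.
rewrite (_ : (\int[mu]_(t in `]0%R, +oo[) _ =
  \int[mu]_(t in `]0%R, +oo[) \int[mu]_(u in `]0%R, +oo[) tail (t, u))%E); last first.
  apply: eq_integral => t; rewrite inE/= in_itv/= andbT; exact: tailE.
rewrite (tonelli_on _ measurable_tail tail_ge0)//.
rewrite (_ : (\int[mu]_(u in `]0%R, +oo[) _ = \int[mu]_(u in `]0%R, +oo[)
  \int[mu]_(s in `]1%R, 2%R]) (u * gamma_density s u)%:E)%E); last first.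
  apply: eq_integral => u; rewrite inE/= in_itv/= andbT => u0.
  transitivity (u%:E * gamma_mix 0 u)%E.
    transitivity (\int[mu]_(t in `]0%R, u[) gamma_mix 0 u)%E.
      rewrite [LHS]integral_mkcond [RHS]integral_mkcond.
      apply: eq_integral => t _; rewrite !patchE /tail/=.
      have -> : (t \in `]0, +oo[%classic) = (0 < t).
        by apply/idP/idP; rewrite inE/= in_itv/= andbT.
      have -> : (t \in `]0, u[%classic) = (0 < t < u).
        by apply/idP/idP; rewrite inE/= in_itv.
      by case: (0 < t); case: (t < u).
    rewrite integral_cst; last exact: measurable_itv.
    by rewrite muleC/= lebesgue_measure_itv/= lte_fin u0 sube0.
  have -> : gamma_mix 0 u = (\int[mu]_(s in `]1%R, 2%R]) (gamma_density s u)%:E)%E.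
    by apply: eq_integral => s _; rewrite addr0.
  rewrite -ge0_integralZl_EFin; last 4 first.
  - exact: measurable_itv.
  - by move=> s _; rewrite lee_fin gamma_density_ge0.
  - exact: (measurable_funTS (measurable_densl u)).
  - exact: ltW.
  by apply: eq_integral => s _; rewrite EFinM.
have mmean : measurable_fun [set: R * R] (fun z => (z.1 * gamma_density z.2 z.1)%:E).
  apply/measurable_EFinP; apply: measurable_funM => //.
  by apply/measurable_EFinP; exact: measurable_dens.
have mean_ge0 (z : R * R) : (0 <= (z.1 * gamma_density z.2 z.1)%:E)%E.
  rewrite lee_fin; have [z0|z0] := leP 0 z.1.
    by rewrite mulr_ge0// gamma_density_ge0.
  by rewrite /gamma_density [0 < z.1]ltNge (ltW z0) andbF mulr0.
have mmean' : measurable_fun [set: R * R] (fun z => (z.2 * gamma_density z.1 z.2)%:E).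
  apply/measurable_EFinP; apply: measurable_funM => //.
  exact: measurable_gamma_density.
rewrite (tonelli_on _ mmean mean_ge0)//.
apply: (@le_trans _ _ (\int[mu]_(s in `]1%R, 2%R]) 2%:E)%E); last first.
  rewrite integral_cst; last exact: measurable_itv.
  rewrite /= lebesgue_measure_itv/= lte_fin ltr1n -EFinB -EFinM lee_fin; lra.
apply: ge0_le_integral.
- exact: measurable_itv.
- by move=> s _; apply: integral_ge0 => u _; exact: (mean_ge0 (u, s)).
- apply: measurable_funTS.
  exact: (measurable_fun_integral_on _ mmean' (fun z => mean_ge0 (z.2, z.1)) _ mI).
- exact: measurable_cst.
move=> s; rewrite /= in_itv/= => /andP[s1 s2].
have s0 : 0 < s by lra.
(* The factor [u] is absorbed by [gamma_densityM], leaving [s] times the mass of the density of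
   shape [s + 1]. *)
rewrite (_ : (\int[mu]_(u in `]0%R, +oo[) _ =
  \int[mu]_(u in `]0%R, +oo[) (s%:E * (gamma_density (s + 1) u)%:E))%E); last first.
  by apply: eq_integral => u _; rewrite gamma_densityM.
rewrite ge0_integralZl_EFin; last 4 first.
- exact: mI.
- by move=> u _; rewrite lee_fin gamma_density_ge0.
- exact: (measurable_funTS (measurable_densr (s + 1))).
- exact: ltW.
by rewrite integral_gamma_density_pos ?mule1 ?lee_fin// ltrDr.
Qed.

(** Each density has mass at most 1, and the shapes fill an interval of length 2. *)
Lemma integral_gamma_mix_head :
  (\int[mu]_(t in `]0%R, +oo[) \int[mu]_(s in `]0%R, 2%R]) (gamma_density s t)%:E
   <= 2%:E)%E.
Proof.
have mI : measurable (`]0, +oo[ : set R) by exact: measurable_itv.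
have mdens' : measurable_fun [set: R * R] (fun z => (gamma_density z.1 z.2)%:E).
  by apply/measurable_EFinP; exact: measurable_gamma_density.
rewrite (tonelli_on _ measurable_dens dens_ge0)//.
apply: (@le_trans _ _ (\int[mu]_(s in `]0%R, 2%R]) 1%:E)%E); last first.
  rewrite integral_cst; last exact: measurable_itv.
  rewrite /= lebesgue_measure_itv/= lte_fin ltr0n -EFinB -EFinM lee_fin; lra.
apply: ge0_le_integral.
- exact: measurable_itv.
- by move=> s _; apply: integral_ge0 => u _; exact: (dens_ge0 (u, s)).
- apply: measurable_funTS.
  exact: (measurable_fun_integral_on _ mdens' (fun z => dens_ge0 (z.2, z.1)) _ mI).
- exact: measurable_cst.
move=> s _; apply: le_trans (integral_gamma_density_le1 s).
apply: ge0_subset_integral.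
- exact: measurable_itv.
- exact: measurableT.
- exact: measurable_densr.
- by move=> t _; rewrite lee_fin gamma_density_ge0.
- exact: subsetT.
Qed.

(** [W] is the sum of the two parts whose difference is S - 1: the shapes up to 2, and the tail of
    [gamma_mix 0]. *)
Lemma kernel_majorant : exists2 W : R -> \bar R,
  [/\ measurable_fun [set: R] W, forall t, (0 <= W t)%E &
    (\int[mu]_t W t < +oo)%E] &
  forall t, 0 < t -> (`|kernelS t - 1|%:E <= W t)%E.
Proof.
have mI : measurable (`]0, +oo[ : set R) by exact: measurable_itv.
pose A t := (\int[mu]_(s in `]0%R, 2%R]) (gamma_density s t)%:E)%E.
pose C t := (\int[mu]_(u in `]0%R, +oo[) tail (t, u))%E.
have A0 t : (0 <= A t)%E by apply: integral_ge0 => s _; exact: (dens_ge0 (t, s)).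
have C0 t : (0 <= C t)%E by apply: integral_ge0 => u _; exact: (tail_ge0 (t, u)).
have mA : measurable_fun [set: R] A.
  by apply: (measurable_fun_integral_on _ measurable_dens dens_ge0); exact: measurable_itv.
have mC : measurable_fun [set: R] C.
  exact: (measurable_fun_integral_on _ measurable_tail tail_ge0).
exists ((fun t => A t + C t)%E \_ `]0, +oo[); first split.
- apply/(measurable_restrictT _ _).1 => //; apply: measurable_funTS.
  exact: emeasurable_funD.
- by move=> t; apply: erestrict_ge0 => u _; rewrite adde_ge0.
- rewrite -integral_mkcond ge0_integralD//; last 2 first.
  + exact: measurable_funTS.
  + exact: measurable_funTS.
  apply: lte_add_pinfty.
    by apply: le_lt_trans integral_gamma_mix_head _; rewrite ltry.
  rewrite (_ : (\int[mu]_(t in `]0%R, +oo[) C t =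
      \int[mu]_(t in `]0%R, +oo[) \int[mu]_(u in `]t, +oo[) gamma_mix 0 u)%E).
    by apply: le_lt_trans integral_gamma_mix_tail _; rewrite ltry.
  by apply: eq_integral => t; rewrite inE/= in_itv/= andbT => t0; rewrite tailE.
move=> t t0; rewrite patchE mem_set/= ?in_itv/= ?t0//.
rewrite kernelSE// integral_gamma_density_shape//.
have := gamma_mix_cdfD_tail t t0; rewrite tailE//.
rewrite -/(C t) -/(A t).
have : (0 <= \int[mu]_(u in `]0%R, t]) gamma_mix 0 u)%E.
  by apply: integral_ge0 => u _; exact: gamma_mix_ge0.
move: (A0 t) (C0 t).
(* Since [b + c = 1], both [b] and [c] are finite. If [a] is finite too, S - 1 is a + b - 1 = a - c;
   if it is infinite, so is the majorant. *)
case: (integral _ _ _) => [b||]//; last by case: (C t).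
case: (C t) => [c||]//; case: (A t) => [a||]//=.
- rewrite !lee_fin => a0 c0 b0 [bc1]; rewrite ler_norml; lra.
- by move=> *; rewrite addye// leey.
Qed.

Lemma measurable_kernelS : measurable_fun (`]0, +oo[ : set R) (@kernelS R).
Proof.
apply: (@eq_measurable_fun _ _ _ _ _ (fun t => fine (\int[mu]_s (gamma_density s t)%:E)%E)).
  by move=> t; rewrite inE/= in_itv/= andbT => t0; rewrite kernelSE.
apply: measurable_funTS; apply: measurableT_comp; first exact: fine_measurable.
exact: (measurable_fun_integral_on _ measurable_dens dens_ge0).
Qed.

End kernel.

(* The integral of a nonnegative function is a supremum over the simple
   functions below it, hence monotone even without measurability. *)
Lemma ge0_le_integralT d (T : measurableType d) (R : realType)
    (mu : {measure set T -> \bar R}) (g h : T -> \bar R) :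
  (forall x, 0 <= g x)%E -> (forall x, g x <= h x)%E ->
  (\int[mu]_x g x <= \int[mu]_x h x)%E.
Proof.
move=> g0 gh; have h0 x : (0 <= h x)%E by exact: le_trans (gh x).
rewrite !ge0_integralTE//; apply: le_ereal_sup => _ [k /= kg <-].
by exists k => //= x; exact: le_trans (kg x) (gh x).
Qed.

(** * Young's inequality for the rescaled kernel *)

Section convolution_bound.
Context {R : realType}.
Local Notation mu := (@lebesgue_measure R).
Variables (a b : R) (f : R -> R).
Hypothesis hf : mu.-integrable `[a, b] (EFin \o f).
Variable W : R -> \bar R.
Hypothesis mW : measurable_fun [set: R] W.
Hypothesis W0 : forall t, (0 <= W t)%E.
Hypothesis kernelW : forall t, 0 < t -> (`|kernelS t - 1|%:E <= W t)%E.

Let absf : R -> \bar R := (fun t => `|f t|%:E) \_ `[a, b].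

Let absf0 t : (0 <= absf t)%E.
Proof. by apply: erestrict_ge0 => u _; rewrite lee_fin. Qed.

Let mf : measurable_fun `[a, b] f.
Proof. by apply/measurable_EFinP; exact: (measurable_int mu). Qed.

Let mabsf : measurable_fun [set: R] absf.
Proof.
apply/(measurable_restrictT _ _).1; first exact: measurable_itv.
by apply/measurable_EFinP; exact: (measurableT_comp _ mf).
Qed.

(** Being nonnegative, this integrand may be integrated over the whole line in each variable,
    dropping the constraints [a <= t < x]. *)
Let conv (alpha : R) (z : R * R) : \bar R := (W ((z.1 - z.2) / alpha) * absf z.2)%E.

Let conv0 alpha z : (0 <= conv alpha z)%E.
Proof. by rewrite mule_ge0. Qed.

Let mconv alpha : measurable_fun [set: R * R] (conv alpha).
Proof.
apply: emeasurable_funM; last exact: (measurableT_comp mabsf measurable_snd).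
apply: (measurableT_comp mW).
by apply: measurable_funM => //; exact: measurable_funB.
Qed.

(** For nonnegative functions Young's inequality is an equality: after Tonelli, the affine
    substitution with centre [t] and scale [alpha] makes the inner integral of [W] independent of
    [t]. *)
Lemma integral_conv alpha : 0 < alpha ->
  (\int[mu]_x \int[mu]_t conv alpha (x, t)
   = alpha%:E * (\int[mu]_t W t * \int[mu]_t absf t))%E.
Proof.
move=> alpha0.
rewrite (tonelli_on _ (mconv alpha) (conv0 alpha))//.
rewrite muleA -ge0_integralZl//; last first.
  by rewrite mule_ge0 ?lee_fin ?(ltW alpha0)// integral_ge0.
apply: eq_integral => t _; rewrite -(ge0_integral_affine _ t)//.
rewrite -ge0_integralZr//.
by apply: (measurableT_comp mW); apply: measurable_funM => //; exact: measurable_funB.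
Qed.

(** Holds at every [x], with no exceptional null set. An infinite right-hand side makes it trivial;
    a finite one makes the integrand of [fracint2] integrable, so that the two real integrals can be
    subtracted. *)
Lemma fracint2_sub_primitive_le alpha x : 0 < alpha -> x <= b ->
  (`|fracint2 a alpha f x - primitive a f x|%:E <= \int[mu]_t conv alpha (x, t))%E.
Proof.
move=> alpha0 xb.
have [->|Gfin] := eqVneq (\int[mu]_t conv alpha (x, t))%E +oo%E; first by rewrite leey.
have axab : `[a, x[ `<=` `[a, b].
  by move=> t; rewrite /= !in_itv/= => /andP[-> /ltW /le_trans]; exact.
have fax : mu.-integrable `[a, x[ (EFin \o f).
  by apply: integrableS hf => //; exact: measurable_itv.
have mfax : measurable_fun `[a, x[ f by apply: measurable_funS mf.
pose k t := kernelS ((x - t) / alpha).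
have mk : measurable_fun `[a, x[ k.
  apply: (measurable_comp _ _ measurable_kernelS).
  - exact: measurable_itv.
  - move=> _ [t + <-]; rewrite /= !in_itv/= andbT => /andP[_ tx].
    by rewrite divr_gt0// subr_gt0.
  - by apply: measurable_funM => //; exact: measurable_funB.
pose g t := k t * f t - f t.
have mg : measurable_fun `[a, x[ g.
  by apply: measurable_funB => //; exact: measurable_funM.
have gle : (\int[mu]_(t in `[a, x[) `|(g t)%:E| <= \int[mu]_t conv alpha (x, t))%E.
  rewrite integral_mkcond; apply: ge0_le_integralT => t.
    by apply: erestrict_ge0 => u _; exact: abse_ge0.
  rewrite patchE; case: ifPn => [|_]; last exact: conv0.
  rewrite inE => axt; rewrite /conv /absf patchE (mem_set (axab _ axt))/=.
  move: axt; rewrite /= in_itv/= => /andP[_ tx].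
  have -> : g t = (k t - 1) * f t by rewrite mulrBl mul1r.
  rewrite normrM EFinM lee_wpmul2r ?lee_fin// kernelW//.
  by rewrite divr_gt0// subr_gt0.
have gint : mu.-integrable `[a, x[ (EFin \o g).
  apply/integrableP; split; first exact/measurable_EFinP.
  by rewrite (le_lt_trans gle)// ltey.
(* [k * f] is recovered as [g + f]. From here on [fracint2] is known to be a genuine integral and
   not a default value. *)
have kfint : mu.-integrable `[a, x[ (EFin \o (fun t => k t * f t)).
  apply: (@eq_integrable _ _ _ mu _ _ ((EFin \o g) \+ (EFin \o f))%E).
  - exact: measurable_itv.
  - by move=> t _ /=; rewrite -EFinD subrK.
  - by apply: integrableD => //; exact: measurable_itv.
rewrite /fracint2 /primitive -Rintegral_itv_bndo_bndc//.
rewrite -RintegralB//.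
rewrite EFin_normr_Rintegral//.
apply: le_trans gle; apply: le_abse_integral => //.
exact/measurable_EFinP.
Qed.

Lemma L1norm_fracint2_sub_primitive_le alpha : 0 < alpha ->
  (L1norm a b (fun x => fracint2 a alpha f x - primitive a f x)%R
   <= alpha%:E * (\int[mu]_t W t * \int[mu]_(t in `[a, b]) `|f t|%:E))%E.
Proof.
move=> alpha0; rewrite /L1norm Lnorm1.
rewrite [X in (_ * (_ * X))%E]integral_mkcond -integral_conv//.
(* The domain [[a, b]] is enlarged to the whole line; [ge0_le_integralT] spares a proof that the
   left-hand side is measurable in [x]. *)
apply: ge0_le_integralT => x; first exact: abse_ge0.
rewrite patchE; case: ifPn => [|_]; last first.
  by rewrite abse0; exact: integral_ge0.
rewrite inE/= in_itv/= => /andP[_ xb].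
exact: fracint2_sub_primitive_le.
Qed.

End convolution_bound.

Theorem theorem3p6 (R : realType) (a b : R) (f : R -> R)
    (hab : a < b)
    (hf : (@lebesgue_measure R).-integrable `[a, b] (EFin \o f)) :
  L1norm a b (fun x => fracint2 a alpha f x - primitive a f x)
    @[alpha --> 0^'+] --> 0%E.
Proof.
have [W [mW W0 Wfin] kernelW] := @kernel_majorant R.
(* The constant of Young's inequality is a product of two finite integrals, hence a real number, so
   that [alpha * c] tends to 0. *)
pose c := fine (\int[@lebesgue_measure R]_t W t *
  \int[@lebesgue_measure R]_(t in `[a, b]) `|f t|%:E)%E.
have cE : (\int[@lebesgue_measure R]_t W t *
    \int[@lebesgue_measure R]_(t in `[a, b]) `|f t|%:E)%E = c%:E.
  rewrite fineK// fin_numM// ge0_fin_numE//.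
  - exact: integral_ge0.
  - by have /integrableP[] := hf.
  - exact: integral_ge0.
apply: (@squeeze_cvge _ _ _ _ (cst 0%E) _ (fun alpha => (alpha * c)%:E)).
- near=> alpha.
  have alpha0 : 0 < alpha by near: alpha; exact: nbhs_right_gt.
  rewrite Lnorm_ge0/= EFinM -cE.
  exact: L1norm_fracint2_sub_primitive_le.
- exact: cvg_cst.
- apply: cvg_EFin; first by apply: nearW.
  rewrite -[X in _ --> X](mul0r c); apply: cvgM; last exact: cvg_cst.
  exact: cvg_at_right_filter.
Unshelve. all: by end_near. Qed.
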